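(* The group $\overline\Gamma=\langle a,t\rangle$ is fractal, weakly branch, and just-non-solvable; however it is not a branch group.
   Context: Let $\Sigma=\{0,1,2\}$ and let $\mathcal T_3=\Sigma^*$ be the ternary rooted tree; automorphisms act on the left on finite words. For a letter $x$ let $\overline x=x+1\bmod 3$. The automorphism $a$ is given by $a(x\sigma)=\overline x\sigma$. The automorphism $t$ is defined recursively (fixing all first-level vertices) by $t(0x\sigma)=0\overline x\sigma$, $t(1x\sigma)=1\overline x\sigma$, $t(2\sigma)=2t(\sigma)$. $\overline\Gamma$ is the subgroup of $\operatorname{Aut}(\mathcal T_3)$ generated by $a$ and $t$ (the bar is just part of the name). For $G<\operatorname{Aut}(\mathcal T_3)$: $\operatorname{Stab}_G(\sigma)$ is the stabilizer of the vertex $\sigma$; if $g$ fixes $\sigma$, $g_{|\sigma}$ is defined by $g(\sigma\tau)=\sigma\,g_{|\sigma}(\tau)$. The rigid stabilizer $\operatorname{Rist}_G(\sigma)$ is the subgroup of elements of $G$ that act trivially on all words not starting with $\sigma$ and act on words starting with $\sigma$ as $\sigma\tau\mapsto\sigma g(\tau)$ for some $g\in G$; and $\operatorname{Rist}_G(n)=\prod_{|\sigma|=n}\operatorname{Rist}_G(\sigma)$. $G$ is fractal if $\operatorname{Stab}_G(\sigma)_{|\sigma}=G$ for every vertex $\sigma$ (identifying the subtree at $\sigma$ with the whole tree). A group $G$ acting transitively on every level $\Sigma^n$ is weakly branch if all $\operatorname{Rist}_G(\sigma)$ are non-trivial, and branch if $\operatorname{Rist}_G(n)$ has finite index in $G$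 for every $n\ge1$. A group is just-non-solvable if it is not solvable but all its quotients by non-trivial normal subgroups are solvable. *)

(* Defs.v *)
From HB Require Import structures.
#[warnings="-notation-overridden"]
From mathcomp Require Import all_boot monoid generic_quotient.
#[warnings="-notation-overridden"]
From mathcomp Require Import boolp classical_sets cardinality.

Set Warnings "-redundant-canonical-projection".
Set Warnings "-projection-no-head-constant".
Set Implicit Arguments.
Unset Strict Implicit.
Unset Printing Implicit Defensive.

Local Open Scope classical_set_scope.
Local Open Scope group_scope.
Local Open Scope quotient_scope.

Definition subgroup_set (gT : groupType) (H : set gT) : Prop :=
  H 1 /\ forall x y, H x -> H y -> H (x * y^-1).

Record subgroup (gT : groupType) := Subgroup {
  sg_set :> set gT;
  sg_setP : subgroup_set sg_set
}.

Section SubgroupType.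
Variables (gT : groupType) (H : subgroup gT).

Definition sg_pred : {pred gT} := fun x => `[< sg_set H x >].

Lemma sg_pred_group : group_closed sg_pred.
Proof.
have [H1 HV] := sg_setP H; split; first exact/asboolP.
by move=> x y /asboolP Hx /asboolP Hy; apply/asboolP; apply: HV.
Qed.

Record sg_type := SgType { sg_val :> gT; sg_valP : sg_val \in sg_pred }.
HB.instance Definition _ := [isSub for sg_val].
HB.instance Definition _ := [Choice of sg_type by <:].
HB.instance Definition _ :=
  SubChoice_isSubGroup.Build gT sg_pred sg_type sg_pred_group.

End SubgroupType.

Lemma setT_subgroup (gT : groupType) : subgroup_set [set: gT].
Proof. by []. Qed.
Definition whole (gT : groupType) := Subgroup (setT_subgroup gT).

Lemma generated_subgroup (gT : groupType) (A : set gT) :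
  subgroup_set (smallest (@subgroup_set gT) A).
Proof.
split=> [K [[K1 _] _] //|x y Hx Hy K [sK AK]].
by case: (sK) => _; apply; [exact: Hx|exact: Hy].
Qed.
Definition generated (gT : groupType) (A : set gT) : subgroup gT :=
  Subgroup (generated_subgroup A).

Definition derived (gT : groupType) (H : subgroup gT) : subgroup gT :=
  generated [set z | exists x y, [/\ sg_set H x, sg_set H y & z = [~ x, y]]].

Definition solvable (gT : groupType) : Prop :=
  exists n, iter n (@derived gT) (whole gT) = [set 1] :> set gT.

Record normal_subgroup (gT : groupType) := NormalSubgroup {
  nsg_sg :> subgroup gT;
  nsg_normal : forall x y, sg_set nsg_sg x -> sg_set nsg_sg (x ^ y)
}.

Section Quotient.
Variables (gT : groupType) (N : normal_subgroup gT).

Definition coset_rel : rel gT := fun x y => `[< sg_set N (x^-1 * y) >].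

Let N1 : sg_set N 1. Proof. by case: (sg_setP N). Qed.
Let NV x : sg_set N x -> sg_set N x^-1.
Proof. by move=> Nx; rewrite -(mul1g x^-1); apply: (sg_setP N).2. Qed.
Let NM x y : sg_set N x -> sg_set N y -> sg_set N (x * y).
Proof. by move=> Nx /NV Ny; rewrite -(invgK y); apply: (sg_setP N).2. Qed.

Lemma coset_rel_equiv : equiv_class_of coset_rel.
Proof.
split=> [x|x y|y x z].
- by apply/asboolP; rewrite mulVg.
- by apply/asboolP/asboolP => /NV; rewrite invgM invgK.
- move=> /asboolP Nxy /asboolP Nyz; apply/asboolP.
  by have := NM Nxy Nyz; rewrite mulgA mulgK.
Qed.
Canonical coset_equiv := EquivRelPack coset_rel_equiv.

Definition quotient := {eq_quot coset_rel}.
HB.instance Definition _ := Choice.on quotient.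
HB.instance Definition _ := EqQuotient.on quotient.

Definition quo_mul (u v : quotient) : quotient := \pi_quotient (repr u * repr v).
Definition quo_one : quotient := \pi_quotient 1.
Definition quo_inv (u : quotient) : quotient := \pi_quotient (repr u)^-1.

Lemma quo_eqP x y : \pi_quotient x = \pi_quotient y <-> sg_set N (x^-1 * y).
Proof.
split=> [/eqP|Nxy]; first by rewrite eqmodE => /asboolP.
by apply/eqP; rewrite eqmodE; apply/asboolP.
Qed.

Lemma quo_surj (u : quotient) : exists x, u = \pi_quotient x.
Proof. by exists (repr u); rewrite reprK. Qed.

Lemma quo_mulE x y : quo_mul (\pi_quotient x) (\pi_quotient y) = \pi_quotient (x * y).
Proof.
apply/quo_eqP; set x' := repr _; set y' := repr _.
have Nx : sg_set N (x'^-1 * x) by apply/quo_eqP; rewrite reprK.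
have Ny : sg_set N (y'^-1 * y) by apply/quo_eqP; rewrite reprK.
have -> : (x' * y')^-1 * (x * y) = (x'^-1 * x) ^ y' * (y'^-1 * y).
  by rewrite /conjg invgM -!mulgA mulVKg.
by apply: NM => //; apply: nsg_normal.
Qed.

Lemma quo_invE x : quo_inv (\pi_quotient x) = \pi_quotient x^-1.
Proof.
apply/quo_eqP; set x' := repr _.
have Nx : sg_set N (x^-1 * x') by apply/quo_eqP; rewrite reprK.
have := nsg_normal x^-1 Nx; rewrite /conjg !invgK -!mulgA mulVKg.
by [].
Qed.

Lemma quo_mulA : associative quo_mul.
Proof.
move=> u v w; case: (quo_surj u) (quo_surj v) (quo_surj w).
by move=> x -> [y ->] [z ->]; rewrite !quo_mulE mulgA.
Qed.
Lemma quo_mul1 : left_id quo_one quo_mul.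
Proof. by move=> u; case: (quo_surj u) => x ->; rewrite quo_mulE mul1g. Qed.
Lemma quo_1mul : right_id quo_one quo_mul.
Proof. by move=> u; case: (quo_surj u) => x ->; rewrite quo_mulE mulg1. Qed.
Lemma quo_mulV : left_inverse quo_one quo_inv quo_mul.
Proof. by move=> u; case: (quo_surj u) => x ->; rewrite quo_invE quo_mulE mulVg. Qed.
Lemma quo_Vmul : right_inverse quo_one quo_inv quo_mul.
Proof. by move=> u; case: (quo_surj u) => x ->; rewrite quo_invE quo_mulE mulgV. Qed.

HB.instance Definition _ :=
  isGroup.Build quotient quo_mulA quo_mul1 quo_1mul quo_mulV quo_Vmul.

End Quotient.

Definition just_non_solvable (gT : groupType) : Prop :=
  ~ solvable gT /\
  forall N : normal_subgroup gT,
    N <> [set 1] :> set gT -> solvable (quotient N).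

Definition finite_index (gT : groupType) (H G : set gT) : Prop :=
  finite_set [set [set x * h | h in H] | x in G].

Definition letter := 'I_3.
Definition word := seq letter.

Definition child (u v : word) : bool := [exists x, v == rcons u x].

Record tree_aut := TreeAut {
  aut_fun :> word -> word;
  aut_inv : word -> word;
  autK : cancel aut_fun aut_inv;
  autVK : cancel aut_inv aut_fun;
  aut_root : aut_fun [::] = [::];
  aut_child : {mono aut_fun : u v / child u v}
}.

HB.instance Definition _ := gen_eqMixin tree_aut.
HB.instance Definition _ := gen_choiceMixin tree_aut.

Lemma tree_autP (g h : tree_aut) : (forall w, g w = h w) -> g = h.
Proof.
case: g h => [g g' gK gVK gr gc] [h h' hK hVK hr hc] /= /funext egh; subst h.
have : g' = h' by apply/funext => w; rewrite -{1}(hVK w) gK.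
move=> e; subst h'.
by congr TreeAut; apply: Prop_irrelevance.
Qed.

Lemma child_id : {mono (id : word -> word) : u v / child u v}.
Proof. by []. Qed.
Definition aut_one : tree_aut :=
  @TreeAut id id (fun=> erefl) (fun=> erefl) erefl child_id.

Section AutMul.
Variables g h : tree_aut.
Lemma aut_mul_root : (g \o h) [::] = [::].
Proof. by rewrite /= !aut_root. Qed.
Lemma aut_mul_child : {mono g \o h : u v / child u v}.
Proof. by move=> u v /=; rewrite !aut_child. Qed.
(* Automorphisms act on the left: (g * h) w = g (h w). *)
Definition aut_mul : tree_aut :=
  TreeAut (can_comp (@autK g) (@autK h)) (can_comp (@autVK h) (@autVK g))
    aut_mul_root aut_mul_child.
Lemma aut_inv_root : aut_inv g [::] = [::].
Proof. by rewrite -{1}(aut_root g) autK. Qed.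
Lemma aut_inv_child : {mono aut_inv g : u v / child u v}.
Proof. by move=> u v; rewrite -(aut_child g) !autVK. Qed.
Definition aut_V : tree_aut :=
  TreeAut (@autVK g) (@autK g) aut_inv_root aut_inv_child.
End AutMul.

Lemma aut_mulA : associative aut_mul.
Proof. by move=> f g h; apply: tree_autP. Qed.
Lemma aut_mul1 : left_id aut_one aut_mul.
Proof. by move=> f; apply: tree_autP. Qed.
Lemma aut_1mul : right_id aut_one aut_mul.
Proof. by move=> f; apply: tree_autP. Qed.
Lemma aut_mulV : left_inverse aut_one aut_V aut_mul.
Proof. by move=> f; apply: tree_autP => w /=; rewrite autK. Qed.
Lemma aut_Vmul : right_inverse aut_one aut_V aut_mul.
Proof. by move=> f; apply: tree_autP => w /=; rewrite autVK. Qed.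

HB.instance Definition _ :=
  isGroup.Build tree_aut aut_mulA aut_mul1 aut_1mul aut_mulV aut_Vmul.

Definition stab (G : set tree_aut) (s : word) : set tree_aut :=
  [set g | G g /\ g s = s].

(* [is_section g s h]: g fixes s and h is g restricted to the subtree at s. *)
Definition is_section (g : tree_aut) (s : word) (h : tree_aut) : Prop :=
  forall w, g (s ++ w) = s ++ h w.

Definition fractal (G : set tree_aut) : Prop :=
  forall s, [set h | exists2 g, stab G s g & is_section g s h] = G.

Definition rist (G : set tree_aut) (s : word) : set tree_aut :=
  [set h | [/\ G h,
               forall w, ~~ prefix s w -> h w = w &
               exists2 g, G g & is_section h s g]].

Definition rist_level (G : set tree_aut) (n : nat) : set tree_aut :=
  [set \prod_(s : n.-tuple letter) f s
     | f in [set f : n.-tuple letter -> tree_aut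
            | forall s : n.-tuple letter, rist G s (f s)]].

Definition level_transitive (G : set tree_aut) : Prop :=
  forall u v : word, size u = size v -> exists2 g, G g & g u = v.

Definition weakly_branch (G : set tree_aut) : Prop :=
  level_transitive G /\ forall s, rist G s <> [set 1].

Definition branch (G : set tree_aut) : Prop :=
  level_transitive G /\
  forall n, (1 <= n)%N -> finite_index (rist_level G n) G.

Definition a_fun (w : word) : word :=
  if w is x :: s then ordS x :: s else [::].

Fixpoint t_fun (w : word) : word :=
  if w is x :: s then
    if x == 2%N :> nat then x :: t_fun s else x :: a_fun s
  else [::].

Lemma child0 v : child [::] v = (size v == 1%N).
Proof.
apply/existsP/eqP => [[x /eqP ->] //|].
by case: v => // x [] // _; exists x.
Qed.

Lemma child_cons0 x u : child (x :: u) [::] = false.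
Proof. by apply/existsP => -[]. Qed.

Lemma child_cons x u y v : child (x :: u) (y :: v) = (x == y) && child u v.
Proof.
apply/existsP/andP => [[z /=]|[/eqP <- /existsP[z /eqP ->]]]; last by exists z.
by rewrite eqseq_cons eq_sym => /andP[-> ?]; split=> //; apply/existsP; exists z.
Qed.

Lemma ordS3 (x : letter) : ordS (ordS (ordS x)) = x.
Proof. by apply: val_inj; case: x => [[|[|[|]]]]. Qed.

Lemma a_fun3 w : a_fun (a_fun (a_fun w)) = w.
Proof. by case: w => //= x s; rewrite ordS3. Qed.

Lemma size_a_fun w : size (a_fun w) = size w.
Proof. by case: w. Qed.

Lemma a_fun_child : {mono a_fun : u v / child u v}.
Proof.
move=> [|x u] [|y v] //=; rewrite ?child0 ?child_cons0 ?child_cons //.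
by rewrite (inj_eq (@ordS_inj 3)).
Qed.

Lemma t_fun3 w : t_fun (t_fun (t_fun w)) = w.
Proof.
elim: w => //= x s IH; case: ifP => x2 /=; rewrite x2 /= x2 ?IH //.
by rewrite a_fun3.
Qed.

Lemma size_t_fun w : size (t_fun w) = size w.
Proof. by elim: w => //= x s IH; case: ifP => /=; rewrite ?size_a_fun ?IH. Qed.

Lemma t_fun_child : {mono t_fun : u v / child u v}.
Proof.
elim=> [|x u IH] v; first by rewrite !child0 size_t_fun.
case: v => [|y v] /=; first by case: ifP; rewrite !child_cons0.
case: ifP => x2; case: ifP => y2; rewrite !child_cons; case: eqP => //= exy.
- by rewrite exy y2 in x2.
- by rewrite exy y2 in x2.
- exact: a_fun_child.
Qed.

Definition aut_a : tree_aut :=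
  @TreeAut a_fun (a_fun \o a_fun) a_fun3 a_fun3 erefl a_fun_child.
Definition aut_t : tree_aut :=
  @TreeAut t_fun (t_fun \o t_fun) t_fun3 t_fun3 erefl t_fun_child.

Definition Gammabar : subgroup tree_aut := generated [set aut_a; aut_t].

(* Main.v *)
Require Import Defs.
From mathcomp Require Import all_boot monoid generic_quotient all_algebra.
From mathcomp Require Import algC algnum cyclotomic ring.
From mathcomp Require Import boolp classical_sets cardinality.

Set Implicit Arguments.
Unset Strict Implicit.
Unset Printing Implicit Defensive.

Import GRing.Theory Num.Theory.
Local Open Scope classical_set_scope.
Local Open Scope group_scope.

(** Everything rests on one family of elements: the conjugates of [t] by powers
    of [a] fix the first level, with section [t] at one letter [x] and [a] at the
    two others ([eval_tconj]).

    Spelling a word with the conjugates at [x] and at [z] in place of [t] and [a]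
    gives an element with that word as its section at [x]. So every element of
    the group is a section of an element that fixes [x] ([exists_section]), which
    gives fractality and, as [a] is transitive on letters, transitivity on all
    levels. The section at the third letter is a power of [a], trivial if the
    length of the word is a multiple of 3. Let [K] be the subgroup of index 3 of
    the elements with such words. Given [u] and [v] in [K], lift [u] with one
    choice of [z] and [v] with the other: the commutator of the lifts is [[u, v]]
    at [x] and trivial elsewhere. Hence [K'] contains a copy of itself on every
    subtree ([branching_K']), and as it is not trivial the group is weakly
    branch.

    A nontrivial subgroup [M] with copies of itself on all subtrees is not
    abelian: an element that moves [s] does not commute with its copy at [s]. As
    [M'] inherits the property, the derived series of [K'] never reaches 1 and
    the group is not solvable.

    Conversely, let [N] be normal and nontrivial. Some element of [N] moves a
    vertex at a level [n], and by transitivity each vertex at that level is moved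
    by an element of [N]. The usual commutator trick with disjoint supports
    ([commg_grafts]) puts the copies of [K''] at level [n] into [N]. On the other
    hand the group acts on the first level through an abelian group, so that
    elements of its derived subgroup of order [n + 3] fix level [n] and have
    sections in its third derived subgroup, which lies in [K'']. Such elements
    are products of copies of elements of [K''], so they lie in [N], and the
    quotient by [N] is solvable ([Gamma_normal_derived]).

    Finally, let [a] and [t] act on the complex plane as the rotations [om * z]
    and [om * z + 1], with [om] a primitive cube root of 1. This is an action of
    the group itself. For the translation part [cocycle w] of a word [w] fixing
    the first level is a combination of those of its sections with powers of [om]
    as weights ([cocycle_sec]), whereas their plain sum depends on the number of
    letters [t] only ([sum_cocycle_sec]). If [w] is a relation, so are its
    sections and the plain sum vanishes. As the weights are 1 modulo [om - 1], an
    induction shows that every power of [om - 1] divides the translation part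
    ([eval1_cocycle_dvd]), which is therefore 0. The same two formulas show
    that an element supported on the subtree at one letter acts trivially on the
    plane. So the rigid stabilizer of the first level acts trivially, whereas
    [t a^-1] acts as the translation by 1: its powers lie in distinct cosets of
    that rigid stabilizer, which thus has infinite index. *)

(** * Subgroups, derived series and homomorphisms *)

Section SubgroupSet.
Variables (gT : groupType) (H : set gT).
Hypothesis sH : subgroup_set H.

Lemma sg1 : H 1. Proof. exact: sH.1. Qed.

Lemma sgV x : H x -> H x^-1.
Proof. by move=> Hx; rewrite -[x^-1]mul1g; apply: sH.2 => //; apply: sg1. Qed.

Lemma sgM x y : H x -> H y -> H (x * y).
Proof. by move=> Hx /sgV Hy; rewrite -[y]invgK; apply: sH.2. Qed.

Lemma sgR x y : H x -> H y -> H [~ x, y].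
Proof.
by move=> Hx Hy; do !apply: sgM => //; apply: sgV.
Qed.

End SubgroupSet.

Lemma subgroup_setP (gT : groupType) (H : set gT) :
    H 1 -> (forall x, H x -> H x^-1) -> (forall x y, H x -> H y -> H (x * y)) ->
  subgroup_set H.
Proof. by move=> H1 HV HM; split=> // x y Hx /HV Hy; apply: HM. Qed.

Lemma derived_comm (gT : groupType) (H : subgroup gT) x y :
  sg_set H x -> sg_set H y -> sg_set (derived H) [~ x, y].
Proof. by move=> Hx Hy K [_]; apply; exists x, y. Qed.

Lemma derived_min (gT : groupType) (H : subgroup gT) (K : set gT) :
    subgroup_set K -> (forall x y, sg_set H x -> sg_set H y -> K [~ x, y]) ->
  derived H `<=` K.
Proof.
by move=> sK HK z; apply; split=> // _ [x [y [Hx Hy ->]]]; apply: HK.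
Qed.

Lemma derivedS (gT : groupType) (H K : subgroup gT) :
  H `<=` K -> derived H `<=` derived K.
Proof.
move=> HK; apply: derived_min; first exact: sg_setP.
by move=> x y /HK Kx /HK Ky; apply: derived_comm.
Qed.

Lemma derived_sub (gT : groupType) (H : subgroup gT) : derived H `<=` H.
Proof. by apply: derived_min => [|x y]; [|apply: sgR]; apply: sg_setP. Qed.

Lemma iter_derivedS (gT : groupType) (H K : subgroup gT) n :
  H `<=` K -> iter n (@derived gT) H `<=` iter n (@derived gT) K.
Proof. by move=> HK; elim: n => //= n; apply: derivedS. Qed.

Section Hom.
Variables (gT rT : groupType) (f : gT -> rT).
Hypothesis fM : {morph f : x y / x * y}.

Lemma hom1 : f 1 = 1.
Proof. by apply: (@mulgI _ (f 1)); rewrite -fM !mulg1. Qed.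

Lemma homV x : f x^-1 = (f x)^-1.
Proof. by apply: (@mulgI _ (f x)); rewrite -fM !mulgV hom1. Qed.

Lemma homR x y : f [~ x, y] = [~ f x, f y].
Proof. by rewrite /commg /conjg !fM !homV. Qed.

Lemma subgroup_image (H : set gT) : subgroup_set H -> subgroup_set (f @` H).
Proof.
move=> sH; apply: subgroup_setP => [|_ [x Hx <-]|_ _ [x Hx <-] [y Hy <-]].
- by exists 1; [apply: sg1 | apply: hom1].
- by exists x^-1; [apply: sgV | rewrite homV].
- by exists (x * y); [apply: sgM | rewrite fM].
Qed.

Lemma subgroup_preimage (H : set rT) : subgroup_set H -> subgroup_set (f @^-1` H).
Proof.
move=> sH; apply: subgroup_setP => [|x|x y] /=.
- by rewrite hom1; apply: sg1.
- by rewrite homV; apply: sgV.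
- by rewrite fM; apply: sgM.
Qed.

Lemma derived_image (A : subgroup gT) (B : subgroup rT) :
  f @` sg_set A = sg_set B -> f @` sg_set (derived A) = derived B.
Proof.
move=> fAB; apply/seteqP; split=> [_ [x + <-]|].
  apply: (derived_min (K := f @^-1` sg_set (derived B))).
    exact: subgroup_preimage (sg_setP _).
  move=> {}x y Ax Ay; rewrite /= homR.
  by apply: derived_comm; rewrite -fAB; [exists x | exists y].
apply: derived_min; first exact: subgroup_image (sg_setP _).
rewrite -fAB => _ _ [x Ax <-] [y Ay <-].
by exists [~ x, y]; [apply: derived_comm | apply: homR].
Qed.

Lemma iter_derived_image (A : subgroup gT) (B : subgroup rT) n :
  f @` sg_set A = sg_set B ->
  f @` sg_set (iter n (@derived gT) A) = iter n (@derived rT) B.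
Proof. by move=> fAB; elim: n => //= n; apply: derived_image. Qed.

End Hom.

Lemma sg_val_image (gT : groupType) (H : subgroup gT) n :
  @sg_val gT H @` sg_set (iter n (@derived _) (whole (sg_type H))) =
  iter n (@derived gT) H.
Proof.
apply: iter_derived_image; first by [].
apply/seteqP; split=> [_ [[x Hx] _ <-]|x Hx]; first exact/asboolP.
by exists (SgType (introT (asboolP _) Hx)).
Qed.

Lemma quotient_derived (gT : groupType) (N : normal_subgroup gT) n :
  iter n (@derived gT) (whole gT) `<=` N -> solvable (quotient N).
Proof.
move=> sDN; exists n; pose p x : quotient N := (\pi_(quotient N) x)%qT.
have pM : {morph p : x y / x * y} by move=> x y; rewrite [RHS]quo_mulE.
rewrite -(@iter_derived_image _ _ p pM (whole gT)); last first.
  by apply/seteqP; split=> // u _; have [x ->] := quo_surj u; exists x.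
apply/seteqP; split=> [_ [x /sDN Nx <-]|_ ->].
  by apply/esym/(quo_eqP N 1 x); rewrite invg1 mul1g.
by exists 1; [apply: sg1 (sg_setP _) | apply: hom1].
Qed.

(** * Automorphisms supported on a subtree *)

Section Graft.
Variables (x : letter) (g : tree_aut).

Definition graft_fun (h : word -> word) (w : word) : word :=
  if w is y :: s then if y == x then y :: h s else w else [::].

Lemma graft_funK (h k : word -> word) :
  cancel h k -> cancel (graft_fun h) (graft_fun k).
Proof.
by move=> hK [|y s] //=; case: ifP => [yx|yx] /=; rewrite yx ?hK.
Qed.

Lemma graft_child : {mono graft_fun g : u v / child u v}.
Proof.
have g0 v : (g v == [::]) = (v == [::]).
  by rewrite -{1}(aut_root g) (can_eq (@autK g)).
case=> [|y u] [|z v] //=.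
- by rewrite !child0; case: ifP => //= _; rewrite !eqSS !size_eq0.
- by case: ifP; rewrite !child_cons0.
- case: ifP => yx; case: ifP => zx; rewrite !child_cons //; case: eqP => //= yz.
  + exact: aut_child.
  + by rewrite -yz yx in zx.
  + by rewrite yz zx in yx.
Qed.

Definition graft : tree_aut :=
  @TreeAut (graft_fun g) (graft_fun (aut_inv g)) (graft_funK (@autK g))
    (graft_funK (@autVK g)) erefl graft_child.

End Graft.

Definition grafts (s : word) (g : tree_aut) : tree_aut := foldr graft g s.

Lemma mulE (g h : tree_aut) w : (g * h) w = g (h w). Proof. by []. Qed.

Lemma graftM x : {morph graft x : g h / g * h}.
Proof.
by move=> g h; apply: tree_autP => -[|y s] //=; case: ifP => //= ->.
Qed.

Lemma graftsM s : {morph grafts s : g h / g * h}.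
Proof. by move=> g h; elim: s => //= x s ->; apply: graftM. Qed.

Lemma grafts_in s (g : tree_aut) w : grafts s g (s ++ w) = s ++ g w.
Proof. by elim: s => //= x s IH; rewrite eqxx IH. Qed.

Lemma grafts_out s (g : tree_aut) w : ~~ prefix s w -> grafts s g w = w.
Proof.
elim: s w => [|x s IH] [|y w] //=; rewrite eq_sym; case: ifP => //= _ ?.
by rewrite IH.
Qed.

Lemma prefix_cat_size (T : eqType) (s t w : seq T) :
  size t = size s -> prefix s (t ++ w) = (s == t).
Proof.
elim: s t => [|x s IH] [|y t] //=; first by rewrite prefix0s.
by move=> [st]; rewrite IH.
Qed.

(** An automorphism that fixes the subtree at [s] pointwise maps its
    complement to itself. *)
Lemma commute_grafts s g (h : tree_aut) :
  (forall w, h (s ++ w) = s ++ w) -> commute h (grafts s g).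
Proof.
move=> hs; apply: tree_autP => w; rewrite !mulE.
have [/prefixP[v ->]|sw] := boolP (prefix s w).
  by rewrite grafts_in !hs grafts_in.
rewrite grafts_out // grafts_out //; apply: contra sw => /prefixP[v hw].
by rewrite -(autK h w) hw -{1}hs autK prefix_prefix.
Qed.

(** For [z] in [N] moving the subtree at [s] off itself, [f] at [s] and its
    conjugate [e^-1] by [z] have disjoint supports. So the element [f e] of [N]
    has the same commutator with [g] at [s] as [f] has. *)
Lemma commg_grafts (N L : set tree_aut) (z : tree_aut) s f g :
    subgroup_set N -> subgroup_set L ->
    (forall x y, N x -> L y -> N (x ^ y)) ->
    N z -> L (grafts s f) -> L (grafts s g) ->
    (forall w, ~~ prefix s (z (s ++ w))) ->
  N (grafts s [~ f, g]).
Proof.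
move=> sN sL NL Nz; rewrite (homR (@graftsM s)).
set F := grafts s f => LF; set G := grafts s g => LG zs.
pose e := z^-1 * F^-1 * z.
have es w : e (s ++ w) = s ++ w.
  rewrite /e !mulE; have -> : F^-1 (z (s ++ w)) = z (s ++ w).
    by rewrite -{1}(@grafts_out s f _ (zs w)); apply: autK.
  exact: autK.
have eF : commute e F by apply: commute_grafts.
have eG : commute e G by apply: commute_grafts.
have NFe : N (F * e).
  have -> : F * e = z^-1 ^ F^-1 * z by rewrite /e /conjg invgK !mulgA.
  by apply: sgM => //; apply: NL; apply: sgV.
have -> : [~ F, G] = [~ F * e, G].
  have /conjg_fixP eG1 : [~ e, G] == 1 by apply/commgP.
  have eR : commute e [~ F, G].
    apply: commuteM; first exact: commuteV.
    by rewrite /conjg; do !apply: commuteM => //; apply: commuteV.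
  rewrite [RHS]commgEl conjMg eG1 invgM -mulgA [_^-1 * (_ * e)]mulgA -/([~ F, G]).
  by rewrite -eR mulKg.
by apply: sgM => //; [apply: sgV | apply: NL].
Qed.

(** * Words in the generators *)

(** In words, [true] stands for [t] and [false] for [a]. Both have order [3],
    so these positive words represent all elements of the group. *)
Fixpoint eval (w : seq bool) : tree_aut :=
  if w is l :: w' then (if l then aut_t else aut_a) * eval w' else 1.

Lemma evalM v w : eval (v ++ w) = eval v * eval w.
Proof. by elim: v => [|l v IH] /=; rewrite ?mul1g // IH mulgA. Qed.

Lemma a3 : aut_a * aut_a * aut_a = 1.
Proof. by apply: tree_autP => w; apply: a_fun3. Qed.

Lemma t3 : aut_t * aut_t * aut_t = 1.
Proof. by apply: tree_autP => w; apply: t_fun3. Qed.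

Fixpoint winv (w : seq bool) : seq bool :=
  if w is l :: w' then winv w' ++ [:: l; l] else [::].

Lemma evalV w : eval (winv w) = (eval w)^-1.
Proof.
elim: w => [|l w IH]; first by rewrite invg1.
rewrite /= evalM IH /= invgM mulg1; congr (_ * _).
by apply/esym/mulg1_eq; case: l; rewrite mulgA ?a3 ?t3.
Qed.

Lemma size_winv w : size (winv w) = (2 * size w)%N.
Proof.
by elim: w => //= l w IH; rewrite size_cat IH /= mulnS addnC.
Qed.

Lemma eval_subgroup : subgroup_set (range eval).
Proof.
apply: subgroup_setP => [|_ [w _ <-]|_ _ [v _ <-] [w _ <-]].
- by exists [::].
- by exists (winv w); rewrite ?evalV.
- by exists (v ++ w); rewrite ?evalM.
Qed.

Lemma GammabarE : sg_set Gammabar = range eval.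
Proof.
apply/seteqP; split=> [g|_ [w _ <-]].
  apply; split=> [|h [->|->]]; first exact: eval_subgroup.
    by exists [:: false]; rewrite //= mulg1.
  by exists [:: true]; rewrite //= mulg1.
have sG := sg_setP Gammabar.
elim: w => [|l w IH]; first exact: (sg1 sG).
apply: (sgM sG) IH.
by move=> K [_]; apply; case: l; [right | left].
Qed.

Lemma Gamma_eval w : sg_set Gammabar (eval w).
Proof. by rewrite GammabarE; exists w. Qed.

(** The image of the letter [x] under [eval w], and a word for the section of
    [eval w] there: passing the letter [y], the generator [t] leaves [t] if
    [y] is [2] and [a] otherwise, whereas [a] leaves nothing. *)
Fixpoint sec (w : seq bool) (x : letter) : letter * seq bool :=
  if w is l :: w' then
    let: (y, v) := sec w' x in
    if l then (y, (y == 2 :> nat) :: v) else (ordS y, v)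
  else (x, [::]).

Lemma eval_cons w x s : eval w (x :: s) = (sec w x).1 :: eval (sec w x).2 s.
Proof.
elim: w => [|[] w IH] //=; rewrite IH; case: (sec w x) => y v //=.
by case: ifP.
Qed.

Lemma Gamma_section g s : sg_set Gammabar g ->
  exists t h, [/\ size t = size s, sg_set Gammabar h &
    forall w, g (s ++ w) = t ++ h w].
Proof.
rewrite GammabarE => -[w _ <-].
elim: s w => [|x s IH] w; first by exists [::], (eval w); split=> //; exists w.
have [t [h [st Gh ht]]] := IH (sec w x).2.
exists ((sec w x).1 :: t), h; split=> //=; first by rewrite st.
by move=> v; rewrite eval_cons ht.
Qed.

(** * Sections *)

Lemma is_section1 s : is_section 1 s 1. Proof. by []. Qed.

Lemma is_sectionM s g g' h h' :
  is_section g s h -> is_section g' s h' -> is_section (g * g') s (h * h').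
Proof. by move=> gh gh' w; rewrite !mulE gh' gh. Qed.

Lemma is_sectionV s g h : is_section g s h -> is_section g^-1 s h^-1.
Proof.
by move=> gh w; rewrite -{1}[w](@autVK h) -gh; apply: (@autK g).
Qed.

Lemma is_sectionR s g g' h h' :
  is_section g s h -> is_section g' s h' -> is_section [~ g, g'] s [~ h, h'].
Proof. by move=> gh gh'; do !apply: is_sectionM => //; apply: is_sectionV. Qed.

(** * Self-similarity: fractality and transitivity *)

Lemma val_iter_ordS n (x : letter) :
  val (iter n (@ordS 3) x) = (x + n) %% 3.
Proof.
elim: n => [|n IH] /=; first by rewrite addn0 modn_small.
by rewrite IH -addn1 modnDml addn1 addnS.
Qed.

Lemma eval_nseq_a n x s : eval (nseq n false) (x :: s) = iter n (@ordS 3) x :: s.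
Proof. by elim: n => //= n ->. Qed.

Lemma eval_nseq_a3 n : 3 %| n -> eval (nseq n false) = 1.
Proof.
move=> n3; apply: tree_autP => -[|x s]; first exact: aut_root.
rewrite eval_nseq_a; congr cons; apply: val_inj.
by rewrite val_iter_ordS -modnDmr (eqP n3) addn0 modn_small.
Qed.

(** The conjugate of [t] by a power of [a] that moves the distinguished letter
    [2] to [x]: its section is [t] at [x] and [a] at the two other letters. *)
Definition tconj (x : letter) : seq bool :=
  nseq x.+1 false ++ true :: nseq (2 - x) false.

Lemma size_tconj x : size (tconj x) = 4.
Proof. by rewrite size_cat /= !size_nseq; case: x => [[|[|[|]]]]. Qed.

Lemma eval_tconj x y s :
  eval (tconj x) (y :: s) = y :: eval [:: y == x] s.
Proof.
by rewrite eval_cons; congr (_ :: eval _ _); first apply: val_inj;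
   case: x y => [[|[|[|]]] ?] // [[|[|[|]]] ?].
Qed.

(** Reading [t] as [tconj x] and [a] as [tconj z] turns [w] into a word whose
    section at [x] is [w] itself. *)
Definition lift_word (x z : letter) (w : seq bool) : seq bool :=
  flatten [seq tconj (if l then x else z) | l <- w].

Lemma size_lift_word x z w : size (lift_word x z w) = (4 * size w)%N.
Proof.
elim: w => // l w IH.
by rewrite mulnS -IH -(size_tconj (if l then x else z)) -size_cat.
Qed.

Lemma section_lift_word x z w y :
  is_section (eval (lift_word x z w)) [:: y]
    (eval [seq y == (if l then x else z) | l <- w]).
Proof.
elim: w => [|l w IH] // s.
rewrite -[lift_word _ _ _]/(tconj _ ++ lift_word x z w) evalM mulE IH.
exact: eval_tconj.
Qed.

Lemma section_lift_word_in x z w : z != x ->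
  is_section (eval (lift_word x z w)) [:: x] (eval w).
Proof.
move=> zx; have := section_lift_word x z w x; congr (is_section _ _ (eval _)).
by rewrite -[RHS]map_id; apply: eq_map => -[]; rewrite ?eqxx // eq_sym (negPf zx).
Qed.

Lemma section_lift_word_out x z w y : y != x -> y != z -> 3 %| size w ->
  is_section (eval (lift_word x z w)) [:: y] 1.
Proof.
move=> /negPf yx /negPf yz w3; rewrite -(eval_nseq_a3 w3).
have := section_lift_word x z w y; congr (is_section _ _ (eval _)).
by elim: w {w3} => //= -[] w ->; rewrite ?yx ?yz.
Qed.

Lemma ordS_neq (x : letter) : ordS x != x.
Proof. by case: x => [[|[|[|]]]]. Qed.

Lemma exists_section w s : exists v, is_section (eval v) s (eval w).
Proof.
elim: s => [|x s [v vP]]; first by exists w.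
exists (lift_word x (ordS x) v) => u; rewrite -cat1s -catA.
by rewrite (section_lift_word_in v (ordS_neq x)) vP.
Qed.

Lemma Gamma_fractal : fractal Gammabar.
Proof.
move=> s; apply/seteqP; split=> [h [g [Gg gs] gh]|].
  have [t [h' [st Gh' gh']]] := Gamma_section s Gg.
  suff -> : h = h' by [].
  apply: tree_autP => w; have /eqP := gh' w.
  by rewrite gh eqseq_cat ?st // => /andP[_ /eqP].
rewrite GammabarE => _ [w _ <-]; have [v vP] := exists_section w s.
exists (eval v) => //; split; first by exists v.
by have := vP [::]; rewrite !cats0 aut_root cats0.
Qed.

Lemma Gamma_transitive : level_transitive Gammabar.
Proof.
suff tr u v : size u = size v -> exists w, eval w u = v.
  by move=> u v /tr[w]; exists (eval w) => //; apply: Gamma_eval.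
elim: u v => [|x u IH] [|y v] //=; first by exists [::].
move=> -[/IH[w wP]].
exists (nseq (y + (3 - x)) false ++ lift_word x (ordS x) w); rewrite evalM mulE.
have /= -> := section_lift_word_in w (ordS_neq x) u.
rewrite wP eval_nseq_a; congr cons; apply: val_inj => /=.
rewrite val_iter_ordS addnCA subnKC; last exact: ltnW.
by rewrite modnDr modn_small.
Qed.

(** * The subgroup [K] and branching over its derived subgroup *)

(** Counting generators modulo [3] is a homomorphism on the group, with [K] as
    its kernel; reading it off a word keeps its well-definedness out of the
    way. *)
Definition K_set : set tree_aut := [set eval w | w in [set w | 3 %| size w]].

Lemma K_subgroup : subgroup_set K_set.
Proof.
apply: subgroup_setP => [|_ [w w3 <-]|_ _ [v v3 <-] [w w3 <-]].
- by exists [::].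
- by exists (winv w); rewrite ?evalV //= size_winv dvdn_mull.
- by exists (v ++ w); rewrite ?evalM //= size_cat dvdn_addr.
Qed.

Definition K : subgroup tree_aut := Subgroup K_subgroup.

Lemma K_eval w : 3 %| size w -> sg_set K (eval w).
Proof. by move=> w3; apply: imageP. Qed.

Lemma K_sub_Gamma : sg_set K `<=` sg_set Gammabar.
Proof. by move=> _ [w _ <-]; apply: Gamma_eval. Qed.

Lemma Gamma_derived_sub_K : sg_set (derived Gammabar) `<=` sg_set K.
Proof.
apply: derived_min; first exact: K_subgroup.
rewrite GammabarE => _ _ [v _ <-] [w _ <-].
exists (winv v ++ winv w ++ v ++ w); last by rewrite !evalM !evalV.
rewrite /= !size_cat !size_winv.
by rewrite addnA -mulnDr -mulSnr dvdn_mulr.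
Qed.

(** For nontrivial [M], regular weak branching over [M]. *)
Definition branching (M : set tree_aut) : Prop :=
  forall x m, M m -> M (graft x m).

Lemma branching_grafts M s m : branching M -> M m -> M (grafts s m).
Proof. by move=> bM; elim: s => //= x s IH Mm; apply/bM/IH. Qed.

Lemma branching_derived (M : subgroup tree_aut) :
  branching (sg_set M) -> branching (sg_set (derived M)).
Proof.
move=> bM x; apply: derived_min.
  exact: subgroup_preimage (@graftM x) _ (sg_setP _).
move=> g h Mg Mh; rewrite /= (homR (@graftM x)).
by apply: derived_comm; apply: bM.
Qed.

(** [K'] contains [graft x [u, v]] for [u], [v] in [K]: lift [u] and [v] to [K]
    so that the sections at [x] are [u] and [v], and that at each other letter
    one of the two sections is trivial. *)
Lemma branching_K' : branching (sg_set (derived K)).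
Proof.
move=> x; apply: derived_min.
  exact: subgroup_preimage (@graftM x) _ (sg_setP _).
move=> _ _ [u u3 <-] [v v3 <-].
have nx2 : ordS (ordS x) != x by case: x => [[|[|[|]]]].
pose ux := lift_word x (ordS x) u; pose vx := lift_word x (ordS (ordS x)) v.
rewrite /preimage /mkset.
have -> : graft x [~ eval u, eval v] = [~ eval ux, eval vx]; last first.
  by apply: derived_comm; apply: K_eval; rewrite size_lift_word dvdn_mull.
apply: tree_autP => -[|y s]; first by rewrite !aut_root.
rewrite [LHS]/=; have [->|yx] := eqVneq y x.
  by rewrite (is_sectionR (section_lift_word_in u (ordS_neq x))
    (section_lift_word_in v nx2)).
have [y1|y1] := eqVneq y (ordS x).
  have y2 : y != ordS (ordS x) by rewrite y1 eq_sym ordS_neq.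
  have := is_sectionR (section_lift_word x (ordS x) u y)
    (section_lift_word_out yx y2 v3).
  by rewrite commg1 => uv; apply/esym/uv.
have := is_sectionR (section_lift_word_out yx y1 u3)
  (section_lift_word x (ordS (ordS x)) v y).
by rewrite comm1g => uv; apply/esym/uv.
Qed.

Lemma K'_neq1 : exists2 m, sg_set (derived K) m & m <> 1.
Proof.
(* These are t a^-1 and a^-1 t; they generate K, and their products in the two
   orders already differ on the word 00. *)
pose x := [:: true; false; false]; pose y := [:: false; false; true].
exists [~ eval x, eval y].
  exact: derived_comm (@K_eval x isT) (@K_eval y isT).
move=> /eqP/commgP xy.
have := congr1 (fun g : tree_aut => [seq val i | i <- g [:: ord0; ord0]]) xy.
by [].
Qed.

Lemma K'_sub_Gamma : sg_set (derived K) `<=` sg_set Gammabar.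
Proof. by move=> m /derived_sub/K_sub_Gamma. Qed.

Lemma grafts_eq1 s m : grafts s m = 1 -> m = 1.
Proof.
move=> sm; apply: tree_autP => w; apply/eqP.
by have /eqP := grafts_in s m w; rewrite sm eqseq_cat // eqxx eq_sym.
Qed.

Lemma Gamma_weakly_branch : weakly_branch Gammabar.
Proof.
split=> [|s s1]; first exact: Gamma_transitive.
have [m Km m1] := K'_neq1; apply: m1; apply: (@grafts_eq1 s).
suff: rist Gammabar s (grafts s m) by rewrite s1.
split=> [|w sw|].
- exact: (K'_sub_Gamma (branching_grafts s branching_K' Km)).
- exact: grafts_out.
- by exists m; [apply: K'_sub_Gamma | apply: grafts_in].
Qed.

(** * Non-solvability *)

Lemma neq1_moves (g : tree_aut) : g <> 1 -> exists s, g s != s.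
Proof.
move=> g1; apply: contrapT => gs; apply: g1; apply: tree_autP => s.
by apply/eqP/negPn/negP => ?; apply: gs; exists s.
Qed.

(** If [m] moves [s], then conjugation by [m] moves the support of the copy of
    [m] at [s] off itself, so [m] does not commute with that copy. *)
Lemma branching_nonabelian (M : subgroup tree_aut) :
    sg_set M `<=` sg_set Gammabar -> branching (sg_set M) ->
    (exists2 m, sg_set M m & m <> 1) ->
  exists2 m, sg_set (derived M) m & m <> 1.
Proof.
move=> MG bM [m Mm m1].
have [s ms] := neq1_moves m1.
exists [~ grafts s m, m].
  by apply: derived_comm => //; apply: branching_grafts.
move=> /eqP/commgP smC; have [t [h [st _ mt]]] := Gamma_section s (MG _ Mm).
have ts : t != s.
  apply: contra_neq ms => ts; have := mt [::].
  by rewrite cats0 aut_root cats0 ts.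
have := congr1 (fun g : tree_aut => g (s ++ s)) smC; rewrite !mulE.
rewrite grafts_in !mt grafts_out; last by rewrite prefix_cat_size // eq_sym.
move=> /eqP; rewrite eqseq_cat // eqxx => /eqP/(can_inj (@autK h))/eqP.
by rewrite eq_sym (negPf ms).
Qed.

Lemma Gamma_not_solvable : ~ solvable (sg_type Gammabar).
Proof.
move=> [n Gn]; pose M := iter n (@derived _) (derived K).
have [sMK [bM [m Mm m1]]] : sg_set M `<=` sg_set (derived K) /\
    branching (sg_set M) /\ exists2 m, sg_set M m & m <> 1.
  rewrite /M; elim: {Gn M} n => [|n [sMK [bM M1]]] /=.
    by split=> //; split; [apply: branching_K' | apply: K'_neq1].
  split; first by move=> m /derived_sub/sMK.
  split; first exact: branching_derived.
  by apply: branching_nonabelian => // m /sMK/K'_sub_Gamma.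
have : sg_set (iter n (@derived _) Gammabar) m.
  exact: (iter_derivedS K'_sub_Gamma Mm).
rewrite -sg_val_image Gn => -[_ -> m1']; apply: m1.
exact: esym m1'.
Qed.

(** * Solvability of proper quotients *)

(** The geometric product of three copies of [M], one for each letter. *)
Definition level1 (M : set tree_aut) : set tree_aut :=
  [set g | forall x : letter, exists2 h, M h & is_section g [:: x] h].

Lemma level1_subgroup M : subgroup_set M -> subgroup_set (level1 M).
Proof.
move=> sM; apply: subgroup_setP => [x|g Mg x|g h Mg Mh x].
- by exists 1; [apply: sg1 | apply: is_section1].
- have [g' Mg' gg'] := Mg x.
  by exists g'^-1; [apply: sgV | apply: is_sectionV].
- have [[g' Mg' gg'] [h' Mh' hh']] := (Mg x, Mh x).
  by exists (g' * h'); [apply: sgM | apply: is_sectionM].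
Qed.

Lemma level1S M N : M `<=` N -> level1 M `<=` level1 N.
Proof. by move=> MN g Mg x; have [h /MN] := Mg x; exists h. Qed.

Lemma derived_level1 (M N : subgroup tree_aut) :
  sg_set M `<=` level1 (sg_set N) ->
  sg_set (derived M) `<=` level1 (sg_set (derived N)).
Proof.
move=> MN; apply: derived_min; first exact/level1_subgroup/sg_setP.
move=> g h /MN Ng /MN Nh x.
have [[g' Ng' gg'] [h' Nh' hh']] := (Ng x, Nh x).
by exists [~ g', h']; [apply: derived_comm | apply: is_sectionR].
Qed.

Lemma sec_fst w x : (sec w x).1 = iter (count negb w) (@ordS 3) x.
Proof.
by elim: w => //= -[] w; rewrite ?add0n ?add1n /= => <-; case: (sec w x).
Qed.

(** The group acts on the first level through powers of one rotation, so
    commutators fix that level. *)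
Lemma Gamma_derived_level1 :
  sg_set (derived Gammabar) `<=` level1 (sg_set Gammabar).
Proof.
apply: derived_min; first exact/level1_subgroup/sg_setP.
rewrite GammabarE => _ _ [v _ <-] [w _ <-] x.
rewrite -GammabarE /commg /conjg -!evalV -!evalM.
set u := _ ++ _; exists (eval (sec u x).2); first exact: Gamma_eval.
move=> s; rewrite /= eval_cons sec_fst; congr (_ :: _).
have winvC z : count negb (winv z) = (2 * count negb z)%N.
  elim: z => //= l z IH; rewrite count_cat IH mulnDr addnC /=.
  by case: l.
apply: val_inj; rewrite val_iter_ordS !count_cat !winvC.
by rewrite [(2 * _ + _)%N]addnA -mulnDr -mulSnr -modnDmr modnMr addn0 modn_small.
Qed.

Lemma Gamma_derived_level n k :
  sg_set (iter (n + k) (@derived _) Gammabar) `<=`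
  iter n level1 (sg_set (iter k (@derived _) Gammabar)).
Proof.
elim: n => // n IH g; rewrite addSn => Gg; apply: (level1S IH); move: g Gg.
elim: (n + k)%N => [|j]; first exact: Gamma_derived_level1.
exact: derived_level1.
Qed.

(** An element of [level1 M] is the product of its three sections, grafted at
    the letters. *)
Lemma level_sub_grafts n (M L : set tree_aut) : subgroup_set L ->
    (forall s m, size s = n -> M m -> L (grafts s m)) ->
  iter n level1 M `<=` L.
Proof.
elim: n L => [|n IH] L sL ML g; first exact: (ML [::]).
move=> Mg; have sub x : iter n level1 M `<=` graft x @^-1` L.
  apply: IH => [|s m sn Mm]; first exact: subgroup_preimage (@graftM x) _ sL.
  by apply: (ML (x :: s)) => //=; rewrite sn.
pose x0 : letter := @Ordinal 3 0 isT; pose x1 : letter := @Ordinal 3 1 isT.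
pose x2 : letter := @Ordinal 3 2 isT.
have [h0 /(sub x0) L0 gh0] := Mg x0; have [h1 /(sub x1) L1 gh1] := Mg x1.
have [h2 /(sub x2) L2 gh2] := Mg x2.
suff -> : g = graft x0 h0 * graft x1 h1 * graft x2 h2.
  exact: (sgM sL (sgM sL L0 L1) L2).
apply: tree_autP => -[|x s]; first by rewrite !aut_root.
have [->|[->|->]] : x = x0 \/ x = x1 \/ x = x2.
- by case: x => [[|[|[|]]] ?] //; [left|right; left|right; right]; apply: val_inj.
- by have /= -> := gh0 s.
- by have /= -> := gh1 s.
- by have /= -> := gh2 s.
Qed.

(** A normal subgroup moving one vertex [s] moves every vertex of its level, by
    transitivity, so it contains the grafts of [K''] at that level; three more
    derivations bring the group into [K'']. *)
Lemma Gamma_normal_derived (N : set tree_aut) :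
    subgroup_set N -> N `<=` sg_set Gammabar ->
    (forall x y, N x -> sg_set Gammabar y -> N (x ^ y)) ->
    (exists2 z, N z & z <> 1) ->
  exists n, sg_set (iter n (@derived _) Gammabar) `<=` N.
Proof.
move=> sN NG nN [z Nz z1].
have [s zs] := neq1_moves z1.
have sG := sg_setP Gammabar.
have NK u m : size u = size s -> sg_set (derived (derived K)) m -> N (grafts u m).
  move=> us Km; move: m Km; apply: (derived_min (K := grafts u @^-1` N)).
    exact: subgroup_preimage (@graftsM u) _ sN.
  have [r Gr ru] := Gamma_transitive us.
  pose zu := z ^ r; have Nzu : N zu by apply: nN.
  have zuu : zu u != u.
    apply: contra zs => /eqP zuu; apply/eqP.
    have := congr1 r zuu; rewrite /zu /conjg !mulE ru.
    by rewrite [r (r^-1 _)](@autVK r).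
  move=> f g Kf Kg; apply: (commg_grafts sN sG nN Nzu).
  - exact: (K'_sub_Gamma (branching_grafts u branching_K' Kf)).
  - exact: (K'_sub_Gamma (branching_grafts u branching_K' Kg)).
  - have [t [h [tu _ zt]]] := Gamma_section u (NG _ Nzu).
    move=> w; rewrite zt prefix_cat_size //; apply: contra zuu => /eqP ut.
    by have := zt [::]; rewrite cats0 aut_root cats0 -ut => ->.
(* Three derivations lead from the group into K, K' and K''. *)
exists (size s + 3)%N => g /Gamma_derived_level.
apply: (level_sub_grafts sN) => u m us Km; apply: NK => //.
exact: (derivedS (derivedS Gamma_derived_sub_K)) Km.
Qed.

Lemma Gamma_just_non_solvable : just_non_solvable (sg_type Gammabar).
Proof.
split=> [|N N1]; first exact: Gamma_not_solvable.
have vM : {morph @sg_val _ Gammabar : x y / x * y} by [].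
have GE (x : sg_type Gammabar) : sg_set Gammabar (sg_val x).
  by case: x => x Gx; apply/asboolP.
have [||||n GN] := @Gamma_normal_derived (@sg_val _ Gammabar @` sg_set N).
- exact: subgroup_image vM _ (sg_setP _).
- by move=> _ [x _ <-].
- move=> _ y [x Nx <-] Gy.
  pose y' := SgType (introT (asboolP _) Gy); exists (x ^ y') => //.
  exact: nsg_normal.
- apply: contra_notP N1 => N1; apply/seteqP; split=> [x Nx|_ ->].
    apply: val_inj; apply: contrapT => x1; apply: N1.
    by exists (sg_val x) => //; exists x.
  exact: sg1 (sg_setP N).
apply: (@quotient_derived _ N n) => x Gx.
have [|y Ny /val_inj <- //] := GN (sg_val x).
by rewrite -sg_val_image; exists x.
Qed.

(** * A cocycle with values in the Eisenstein integers *)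

Definition om : algC := sval (C_prim_root_exists (isT : 0 < 3)).

Lemma om_prim : (3.-primitive_root om)%R.
Proof. exact: svalP (C_prim_root_exists (isT : 0 < 3)). Qed.

Lemma om_expr_mod n : (om ^+ (n %% 3) = om ^+ n)%R.
Proof. exact: (prim_expr_mod om_prim). Qed.

Lemma om_sum : (1 + om + om ^+ 2 = 0)%R.
Proof.
have : ((om - 1) * (1 + om + om ^+ 2) = 0)%R.
  by transitivity (om ^+ 3 - 1)%R; [ring | rewrite (prim_expr_order om_prim) subrr].
move=> /eqP; rewrite mulf_eq0 subr_eq0 => /orP[/eqP om1|/eqP //].
by have := prim_order_dvd om_prim 1; rewrite om1 expr1 eqxx.
Qed.

Lemma om_Aint : om \in Aint.
Proof. exact: (Aint_prim_root om_prim). Qed.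

(** The translation part of [w] when [a] and [t] act on the complex plane as
    the rotations [om * z] and [om * z + 1]. *)
Fixpoint cocycle (w : seq bool) : algC :=
  if w is l :: w' then (om * cocycle w' + l%:R)%R else 0%R.

Lemma cocycle_cat v w :
  (cocycle (v ++ w) = cocycle v + om ^+ size v * cocycle w)%R.
Proof.
elim: v => [|l v IH] /=; first by rewrite expr0 mul1r add0r.
by rewrite IH exprS; ring.
Qed.

Lemma cocycle_Aint w : cocycle w \in Aint.
Proof.
elim: w => [|l w IH] /=; first exact: rpred0.
by rewrite rpredD ?rpred_nat // rpredM // om_Aint.
Qed.

Lemma cocycle_nseq_t n : 3 %| n -> cocycle (nseq n true) = 0%R.
Proof.
move=> /dvdnP[k ->]; elim: k => //= k ->.
transitivity (1 + om + om ^+ 2)%R; last exact: om_sum.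
by ring.
Qed.

Lemma sec_cons l w x :
  sec (l :: w) x =
  if l then ((sec w x).1, (val (sec w x).1 == 2) :: (sec w x).2)
  else (ordS (sec w x).1, (sec w x).2).
Proof. by rewrite /=; case: (sec w x). Qed.

Lemma size_sec w x : size (sec w x).2 = count id w.
Proof. by elim: w => // -[] w IH; rewrite sec_cons /= IH. Qed.

Lemma big_iter_ordS (T : Type) idx (op : Monoid.com_law idx) n (F : letter -> T) :
  \big[op/idx]_x F (iter n (@ordS 3) x) = \big[op/idx]_x F x.
Proof.
elim: n F => // n IH F; rewrite (IH (fun x => F (ordS x))).
by rewrite [RHS](reindex_inj (@ordS_inj 3)).
Qed.

Lemma big_sec (T : Type) idx (op : Monoid.com_law idx) w (F : letter -> T) :
  \big[op/idx]_x F (sec w x).1 = \big[op/idx]_x F x.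
Proof.
rewrite -[RHS](big_iter_ordS _ (count negb w)).
by apply: eq_bigr => x _; rewrite sec_fst.
Qed.

Lemma sum_letter2 (R : pzSemiRingType) (F : letter -> R) :
  (\sum_x F x * (val x == 2)%:R = F (inord 2))%R.
Proof.
rewrite (bigD1 (inord 2)) //= inordK // eqxx mulr1 big1 ?addr0 // => x x2.
case: eqP => [e|_]; last by rewrite mulr0.
by case/eqP: x2; apply: val_inj; rewrite /= inordK.
Qed.

(** Each letter [t] of [w] contributes [t] to exactly one of the sections, and
    [a] to the two others, whereas the letters [a] of [w] contribute nothing. *)
Lemma count_sec w : \sum_x count id (sec w x).2 = count id w.
Proof.
elim: w => [|[] w IH]; [by rewrite big1| |].
  under eq_bigr do rewrite sec_cons /=.
  rewrite big_split /= IH; congr addn.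
  rewrite (big_sec _ w (fun y => nat_of_bool (val y == 2))).
  by rewrite !big_ord_recl big_ord0.
by under eq_bigr do rewrite sec_cons /=.
Qed.

(** The sections all have the same length, and a letter [t] of [w] stands at the
    same position in each of them; it is a [t] in exactly one. *)
Lemma sum_cocycle_sec w :
  (\sum_x cocycle (sec w x).2 = cocycle (nseq (count id w) true))%R.
Proof.
elim: w => [|[] w IH]; [by rewrite big1| |].
  under eq_bigr do rewrite sec_cons /= -[_%:R%R]mul1r.
  rewrite big_split /= -mulr_sumr IH; congr (_ + _)%R.
  rewrite (big_sec _ w (fun y => 1 * (val y == 2)%:R)%R).
  exact: (sum_letter2 (fun=> 1%R)).
by under eq_bigr do rewrite sec_cons /=.
Qed.

(** The letter [t] that becomes a [t] in the section at [x] acts when [x] has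
    been rotated to [2]. The letters [a] between it and the left end of [w], which
    the section forgets, thus number [x + 1] plus all letters [a] of [w], modulo
    [3]; each of them contributes a factor [om]. *)
Lemma cocycle_sec w :
  (cocycle w = om ^+ count negb w *
    \sum_(x : letter) om ^+ x.+1 * cocycle (sec w x).2)%R.
Proof.
elim: w => [|[] w IH]; first by rewrite big1 ?mulr0 // => x _; rewrite mulr0.
  under eq_bigr do rewrite sec_cons /= mulrDr.
  rewrite big_split mulrDr /= {}IH; congr (_ + _)%R.
    rewrite add0n mulrCA; congr (_ * _)%R; rewrite mulr_sumr.
    by apply: eq_bigr => x _; rewrite mulrCA.
  pose F (y : letter) := (om ^+ y.+1 * (val y == 2)%:R)%R.
  transitivity (\sum_x F (sec w x).1)%R.
    rewrite (big_sec _ w F) (sum_letter2 (fun y => om ^+ y.+1)%R) inordK //.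
    by rewrite (prim_expr_order om_prim).
  rewrite mulr_sumr; apply: eq_bigr => x _; rewrite /F mulrA; congr (_ * _)%R.
  rewrite sec_fst val_iter_ordS add0n -exprD -om_expr_mod -[RHS]om_expr_mod.
  by congr (_ ^+ _)%R; rewrite -addn1 modnDml addn1 addnS addnC.
by under eq_bigr do rewrite sec_cons /=; rewrite /= addr0 IH add1n exprS mulrA.
Qed.

(** * Relations of the group are invisible to the cocycle *)

Lemma eval1_count_a w : eval w = 1 -> 3 %| count negb w.
Proof.
move=> w1; have := eval_cons w ord0 [::]; rewrite w1 => -[+ _].
move=> /(congr1 val); rewrite sec_fst val_iter_ordS /= => /esym.
by move/eqP.
Qed.

Lemma eval1_sec w x : eval w = 1 -> eval (sec w x).2 = 1.
Proof.
move=> w1; apply: tree_autP => s; have := eval_cons w x s.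
by rewrite w1 => -[_ <-].
Qed.

(** The sections contain together twice as many letters [a] as [w] contains
    letters [t]; but they are relations as well, so their letters [a] come in
    multiples of [3]. *)
Lemma eval1_count_t w : eval w = 1 -> 3 %| count id w.
Proof.
move=> w1; rewrite -(@Gauss_dvdr _ 2) //.
have -> : (2 * count id w = \sum_x count negb (sec w x).2)%N.
  apply/eqP; rewrite -(eqn_add2l (\sum_x count id (sec w x).2)) -big_split /=.
  under [X in _ == X]eq_bigr do rewrite (count_predC id) size_sec.
  by rewrite count_sec sum_nat_const card_ord mulSn.
apply: dvdn_sum => x _; exact/eval1_count_a/eval1_sec.
Qed.

(** Vanishing in the [(om - 1)]-adic topology. The ideal generated by [om - 1]
    lies above [3], which makes this condition exclude nonzero natural numbers. *)
Definition inf_dvd (z : algC) : Prop :=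
  forall k, exists2 y, y \in Aint & z = ((om - 1) ^+ k * y)%R.

Lemma inf_dvd0 : inf_dvd 0%R.
Proof. by move=> k; exists 0%R; [apply: rpred0 | rewrite mulr0]. Qed.

Lemma inf_dvdD z1 z2 : inf_dvd z1 -> inf_dvd z2 -> inf_dvd (z1 + z2)%R.
Proof.
move=> d1 d2 k; have [[y1 A1 ->] [y2 A2 ->]] := (d1 k, d2 k).
by exists (y1 + y2)%R; [apply: rpredD | rewrite mulrDr].
Qed.

Lemma inf_dvdM u z : u \in Aint -> inf_dvd z -> inf_dvd (u * z)%R.
Proof.
move=> Au dz k; have [y Ay ->] := dz k.
by exists (u * y)%R; [apply: rpredM | rewrite mulrCA].
Qed.

Lemma inf_dvdN z : inf_dvd z -> inf_dvd (- z)%R.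
Proof. by rewrite -mulN1r; apply: inf_dvdM; rewrite rpredN rpred1. Qed.

Lemma inf_dvd_nat m : inf_dvd m%:R%R -> m = 0.
Proof.
move=> dm; have [z Az] := dm (2 * m)%N.
(* The square of [om - 1] is [3] up to a unit. *)
have om2 : ((om - 1) ^+ 2 = 3%:R * (- om))%R.
  transitivity ((om - 1) ^+ 2 - (1 + om + om ^+ 2))%R; last by ring.
  by rewrite om_sum subr0.
rewrite exprM om2 exprMn -mulrA -natrX => mz.
have : (m == 0 %[mod (3 ^ m)%N])%A.
  rewrite (nCdivE m) mz; apply: eqAmodMr0.
  by rewrite rpredM // rpredX // rpredN om_Aint.
rewrite eqAmod0_nat; case: m {dm mz} => // m /(dvdn_leq (ltn0Sn m)).
by rewrite leqNgt ltn_expl.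
Qed.

(** If [w] is a relation, so are its sections, and by [sum_cocycle_sec] their
    cocycles add up to [0]; modulo [om - 1] the weights in [cocycle_sec] are all
    [1], so one more factor [om - 1] divides the cocycle of [w]. *)
Lemma eval1_cocycle_dvd w : eval w = 1 -> inf_dvd (cocycle w).
Proof.
move=> + k; elim: k w => [|k IH] w w1.
  by exists (cocycle w); [apply: cocycle_Aint | rewrite expr0 mul1r].
have IHx x := IH _ (eval1_sec x w1).
have := sum_cocycle_sec w; rewrite cocycle_nseq_t ?eval1_count_t //.
rewrite [cocycle w]cocycle_sec -om_expr_mod (eqP (eval1_count_a w1)) expr0 mul1r.
rewrite !big_ord_recl !big_ord0 /= !addr0.
have [[z0 A0 ->] [z1 A1 ->]] := (IHx ord0, IHx (lift ord0 ord0)).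
rewrite expr1 [(_ ^+ k.+1)%R]exprS.
move: (cocycle _) ((om - 1) ^+ k)%R => c2 p c012.
have -> : c2 = (- (p * z0) - p * z1)%R.
  transitivity (c2 - (p * z0 + (p * z1 + c2)))%R; last by ring.
  by rewrite c012 subr0.
exists (z0 + (om + 1) * z1)%R.
  by rewrite rpredD // rpredM // rpredD ?om_Aint ?rpred1.
by rewrite /bump /= (prim_expr_order om_prim); ring.
Qed.

(** * Rigid stabilizers have infinite index *)

(** The kernel of the action on the plane, written with [inf_dvd] in place of
    vanishing because this is the form in which [eval1_cocycle_dvd] controls
    cocycles. *)
Definition untranslated : set tree_aut :=
  [set eval w | w in [set w | 3 %| size w /\ inf_dvd (cocycle w)]].

(** The sections of an element of a rigid stabilizer are trivial at all letters
    but one, so that all but one summand in [sum_cocycle_sec] are negligible,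
    hence the last one is. *)
Lemma rist_untranslated x h : rist Gammabar [:: x] h -> untranslated h.
Proof.
move=> [+ hx _]; rewrite GammabarE => -[w _ wh]; subst h; exists w => //.
have out y s : y != x -> eval w (y :: s) = y :: s.
  by move=> yx; apply: hx; rewrite /= eq_sym (negPf yx).
have sec1 y : y != x -> eval (sec w y).2 = 1.
  move=> yx; apply: tree_autP => s; have := out y s yx.
  by rewrite eval_cons => -[].
have xS : ordS x != x by apply: ordS_neq.
have wa : 3 %| count negb w.
  have := out (ordS x) [::] xS; rewrite eval_cons => -[/(congr1 val) + _].
  rewrite sec_fst val_iter_ordS -[RHS](modn_small (ltn_ord _)).
  by move/eqP; rewrite -[X in _ == X %% 3]addn0 eqn_modDl mod0n.
have wt : 3 %| count id w.
  rewrite -(size_sec w (ordS x)) -(count_predC id) dvdn_add //.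
    exact/eval1_count_t/sec1.
  exact/eval1_count_a/sec1.
split; first by rewrite -(count_predC id) dvdn_add.
have dsec y : inf_dvd (cocycle (sec w y).2).
  have [->|/sec1/eval1_cocycle_dvd //] := eqVneq y x.
  have := sum_cocycle_sec w; rewrite cocycle_nseq_t // (bigD1 x) //=.
  move/eqP; rewrite addr_eq0 => /eqP ->; apply: inf_dvdN.
  apply: big_ind => [||z /sec1/eval1_cocycle_dvd //].
    exact: inf_dvd0.
  exact: inf_dvdD.
rewrite cocycle_sec; apply: inf_dvdM; first by rewrite rpredX // om_Aint.
apply: big_ind => [||z _]; [exact: inf_dvd0 | exact: inf_dvdD |].
by apply: inf_dvdM; first rewrite rpredX // om_Aint.
Qed.

Lemma rist_level1_untranslated : rist_level Gammabar 1 `<=` untranslated.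
Proof.
move=> _ [f fr <-]; apply: big_ind => [|_ _ [v [v3 dv] <-] [w [w3 dw] <-]|s _].
- by exists [::] => //; split=> //; apply: inf_dvd0.
- exists (v ++ w); rewrite ?evalM //; split; first by rewrite size_cat dvdn_add.
  rewrite cocycle_cat; apply: inf_dvdD => //; apply: inf_dvdM => //.
  by rewrite rpredX // om_Aint.
- have := fr s; case: (tupleP s) => x s'; rewrite [s']tuple0.
  exact: rist_untranslated.
Qed.

(** A word for the [n]-th power of [t a^-1], the translation of the plane by
    [n]. *)
Definition transl (n : nat) : seq bool :=
  flatten (nseq n [:: true; false; false]).

Lemma translD m n : transl (m + n) = transl m ++ transl n.
Proof. by rewrite /transl nseqD flatten_cat. Qed.

Lemma cocycle_transl n : cocycle (transl n) = n%:R%R.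
Proof.
rewrite /transl; elim: n => //= n ->; rewrite !addr0 [RHS]mulrSr; congr (_ + _)%R.
by rewrite !mulrA -expr2 -exprSr (prim_expr_order om_prim) mul1r.
Qed.

Lemma transl_untranslated n : untranslated (eval (transl n)) -> n = 0.
Proof.
move=> [w [w3 dw] wn]; apply: inf_dvd_nat.
have dV : inf_dvd (cocycle (winv w)).
  have -> : cocycle (winv w) =
      (cocycle (winv w ++ w) + (- om ^+ size (winv w)) * cocycle w)%R.
    by rewrite cocycle_cat mulNr addrK.
  apply: inf_dvdD.
    by apply: eval1_cocycle_dvd; rewrite evalM evalV mulVg.
  by apply: inf_dvdM; rewrite // rpredN rpredX // om_Aint.
have -> : n%:R%R = (cocycle (winv w ++ transl n) - cocycle (winv w))%R.
  rewrite cocycle_cat cocycle_transl size_winv -om_expr_mod.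
  by rewrite -modnMmr (eqP w3) muln0 mod0n expr0 mul1r addrAC subrr add0r.
apply: inf_dvdD; last exact: inf_dvdN.
by apply: eval1_cocycle_dvd; rewrite evalM evalV wn mulVg.
Qed.

Lemma Gamma_not_branch : ~ branch Gammabar.
Proof.
move=> [_ /(_ 1%N isT)]; set R := rist_level _ _ => finR; apply: infinite_nat.
pose f n : set tree_aut := [set eval (transl n) * h | h in R].
have f_lt m n : m < n -> f m <> f n.
  move=> mn fmn; have : f n (eval (transl n)).
    exists 1; last exact: mulg1.
    exists (fun=> 1); last by rewrite big1.
    move=> s; have sG := sg_setP Gammabar.
    by split=> //; [apply: (sg1 sG) | exists 1 => //; apply: (sg1 sG)].
  rewrite -fmn => -[h /rist_level1_untranslated uh].
  rewrite -{1}(subnKC (ltnW mn)) translD evalM => /mulgI hn.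
  move: uh; rewrite hn => /transl_untranslated/eqP.
  by rewrite subn_eq0 leqNgt mn.
have f_inj : {in [set: nat] &, injective f}.
  move=> m n _ _ fmn; case: (ltngtP m n) => // [/f_lt //|/f_lt []].
  exact: esym.
rewrite -(eq_finite_set (inj_card_eq f_inj)); apply: sub_finite_set finR.
by move=> _ [n _ <-]; exists (eval (transl n)) => //; apply: Gamma_eval.
Qed.

Theorem proposition7p3 :
  [/\ fractal Gammabar,
      weakly_branch Gammabar,
      just_non_solvable (sg_type Gammabar) &
      ~ branch Gammabar].
Proof.
split.
- exact: Gamma_fractal.
- exact: Gamma_weakly_branch.
- exact: Gamma_just_non_solvable.
- exact: Gamma_not_branch.
Qed.
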